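(* For graphs $G_1,\ldots,G_d$, $$\mathrm{boxicity}\left(\times_{i=1}^d G_i\right) \leq \mathrm{boxicity}\left(\boxtimes_{i=1}^d G_i\right) + \mathrm{boxicity}\left(\times_{i=1}^d K_{\chi_i}\right)$$ and $$\mathrm{cubicity}\left(\times_{i=1}^d G_i\right) \leq \mathrm{cubicity}\left(\boxtimes_{i=1}^d G_i\right) + \mathrm{cubicity}\left(\times_{i=1}^d K_{\chi_i}\right),$$ where $\chi_i$ denotes the chromatic number of $G_i$, $i\in[d]$.
   Context: All graphs are finite, undirected and simple. $[d]=\{1,\ldots,d\}$ and $K_n$ is the complete graph on $n$ vertices. A $k$-box is a Cartesian product of $k$ closed intervals of $\mathbb{R}$, and a $k$-cube is a Cartesian product of $k$ closed intervals of unit length. A $k$-box ($k$-cube) representation of a graph $G$ is a function $f$ mapping each vertex to a $k$-box ($k$-cube) such that for any two distinct vertices $u,v$, $uv\in E(G)$ if and only if $f(u)\cap f(v)\neq\emptyset$. The boxicity (cubicity) of $G$ is the smallest natural number $k$ (with $0$ allowed; complete graphs have boxicity and cubicity $0$) such that $G$ has a $k$-box ($k$-cube) representation. The following products of $G_1$ and $G_2$ have vertex set $V(G_1)\times V(G_2)$. In the strong product $G_1\boxtimes G_2$, two distinct vertices $(u_1,u_2)$, $(v_1,v_2)$ are adjacent iff ($u_1=v_1$ or $u_1v_1\in E(G_1)$) and ($u_2=v_2$ or $u_2v_2\in E(G_2)$). In the direct product $G_1\times G_2$, they are adjacent iff $u_1v_1\in E(G_1)$ and $u_2v_2\in E(G_2)$.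 $\boxtimes_{i=1}^d$ and $\times_{i=1}^d$ denote the iterated products. *)

(* Defs.v *)
From HB Require Import structures.
From mathcomp Require Import all_boot all_order all_algebra.
From mathcomp Require Import boolp classical_sets reals.
From mathcomp Require Import lra.
Set Implicit Arguments.
Unset Strict Implicit.
Unset Printing Implicit Defensive.
Import Order.TTheory GRing.Theory Num.Theory.
Local Open Scope ring_scope.
Local Open Scope classical_set_scope.

Record sgraph := SGraph {
  vertex :> finType;
  edge : rel vertex;
  edge_sym : symmetric edge;
  edge_irr : irreflexive edge }.

Section CompleteGraph.
Variable n : nat.
Definition complete_edge : rel 'I_n := fun u v => u != v.
Lemma complete_sym : symmetric complete_edge.
Proof. by move=> u v; rewrite /complete_edge eq_sym. Qed.
Lemma complete_irr : irreflexive complete_edge.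
Proof. by move=> u; rewrite /complete_edge eqxx. Qed.
Definition complete_graph : sgraph := SGraph complete_sym complete_irr.
End CompleteGraph.

Section Products.
Variables G1 G2 : sgraph.

Definition strong_edge : rel (G1 * G2)%type := fun u v =>
  [&& u != v, (u.1 == v.1) || edge u.1 v.1 & (u.2 == v.2) || edge u.2 v.2].
Lemma strong_sym : symmetric strong_edge.
Proof.
by move=> u v; rewrite /strong_edge !(eq_sym u) !(eq_sym u.1) !(eq_sym u.2)
  (edge_sym u.1) (edge_sym u.2).
Qed.
Lemma strong_irr : irreflexive strong_edge.
Proof. by move=> u; rewrite /strong_edge eqxx. Qed.
Definition strong_prod : sgraph := SGraph strong_sym strong_irr.

Definition direct_edge : rel (G1 * G2)%type := fun u v =>
  edge u.1 v.1 && edge u.2 v.2.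
Lemma direct_sym : symmetric direct_edge.
Proof. by move=> u v; rewrite /direct_edge (edge_sym u.1) (edge_sym u.2). Qed.
Lemma direct_irr : irreflexive direct_edge.
Proof. by move=> u; rewrite /direct_edge edge_irr. Qed.
Definition direct_prod : sgraph := SGraph direct_sym direct_irr.
End Products.

(* (... (G 0 op G 1) op ...) op G n, for a family of n.+1 graphs.  Empty
   families are excluded: the direct product has no neutral element among
   simple graphs. *)
Fixpoint iter_prod (op : sgraph -> sgraph -> sgraph) (n : nat) :
    ('I_n.+1 -> sgraph) -> sgraph :=
  match n with
  | 0 => fun G => G ord0
  | m.+1 => fun G =>
      op (iter_prod op (fun i : 'I_m.+1 => G (widen_ord (leqnSn _) i)))
         (G ord_max)
  end.

Section Chromatic.
Variable G : sgraph.

Definition colorable (n : nat) : bool :=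
  [exists c : {ffun G -> 'I_n},
    [forall u, forall v, edge u v ==> (c u != c v)]].

Lemma ex_colorable : exists n, colorable n.
Proof.
exists #|G|; apply/existsP; exists [ffun u => enum_rank u].
apply/forallP => u; apply/forallP => v; apply/implyP => uv.
rewrite !ffunE; apply: contraTneq uv => /enum_rank_inj ->.
by rewrite edge_irr.
Qed.

Definition chromatic_number : nat := ex_minn ex_colorable.
End Chromatic.

Section Boxicity.
Variable R : realType.

Definition is_box (k : nat) (B : set 'rV[R]_k) : Prop :=
  exists a b : 'I_k -> R, (forall i, a i <= b i) /\
    B = [set x | forall i, a i <= x ord0 i <= b i].

Definition is_cube (k : nat) (B : set 'rV[R]_k) : Prop :=
  exists a : 'I_k -> R,
    B = [set x | forall i, a i <= x ord0 i <= a i + 1].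

Lemma is_cube_box (k : nat) (B : set 'rV[R]_k) : is_cube B -> is_box B.
Proof.
by move=> [a ->]; exists a, (fun i => a i + 1); split => // i; rewrite lerDl.
Qed.

Definition is_intersection_rep (k : nat) (G : sgraph)
    (f : G -> set 'rV[R]_k) : Prop :=
  forall u v : G, u != v -> (edge u v <-> f u `&` f v !=set0).

Definition has_box_rep (G : sgraph) (k : nat) : Prop :=
  exists f : G -> set 'rV[R]_k, (forall v, is_box (f v)) /\ is_intersection_rep f.

Definition has_cube_rep (G : sgraph) (k : nat) : Prop :=
  exists f : G -> set 'rV[R]_k, (forall v, is_cube (f v)) /\ is_intersection_rep f.

(* One coordinate per vertex w: w gets [0, 1], its neighbours [1, 2] and all
   other vertices [2, 3]. *)
Lemma has_cube_rep_card (G : sgraph) : has_cube_rep G #|G|.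
Proof.
pose a (u w : G) : R := if u == w then 0 else if edge u w then 1 else 2.
exists (fun u => [set x | forall i,
  a u (enum_val i) <= x ord0 i <= a u (enum_val i) + 1]); split.
  by move=> u; exists (fun i => a u (enum_val i)).
move=> u v uv; split => [euv|[x [/= xu xv]]].
  exists (\row_i Num.max (a u (enum_val i)) (a v (enum_val i))).
  have key w : a u w <= a v w + 1 /\ a v w <= a u w + 1.
    rewrite /a; have [<-|_] := eqVneq u w.
      by rewrite eq_sym (negPf uv) edge_sym euv; split; lra.
    have [<-|_] := eqVneq v w; first by rewrite euv; split; lra.
    by case: (edge u w); case: (edge v w); split; lra.
  by split => i /=; rewrite mxE le_max ge_max ?lexx ?orbT /= lerDl ler01
    /= ?andbT; case: (key (enum_val i)).
apply: contraT => nuv.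
have := xu (enum_rank u); have := xv (enum_rank u).
rewrite !enum_rankK /a eqxx eq_sym (negPf uv) edge_sym (negPf nuv).
by move=> /andP[x2 _] /andP[_ x1]; lra.
Qed.

Lemma ex_cube_rep (G : sgraph) : exists k, `[< has_cube_rep G k >].
Proof. by exists #|G|; apply/asboolP/has_cube_rep_card. Qed.

Lemma ex_box_rep (G : sgraph) : exists k, `[< has_box_rep G k >].
Proof.
exists #|G|; apply/asboolP; have [f [fc fr]] := has_cube_rep_card G.
by exists f; split => // v; apply/is_cube_box/fc.
Qed.

Definition boxicity (G : sgraph) : nat := ex_minn (ex_box_rep G).
Definition cubicity (G : sgraph) : nat := ex_minn (ex_cube_rep G).

End Boxicity.

(* Main.v *)
Require Import Defs.
From mathcomp Require Import all_boot all_order all_algebra.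
From mathcomp Require Import boolp classical_sets reals.

(** Colour each factor properly: this maps the direct product D of the G_i to
    the direct product C of the K_chi_i, while D sits on the vertex set of the
    strong product S.  Two vertices are adjacent in D iff they are adjacent in
    S and their colour vectors are adjacent in C, so the Cartesian product of
    a representation of S with the pullback of one of C represents D.  Distinct
    vertices with the same colour vector, whose boxes from C coincide, are
    harmless: they are never adjacent in S. *)

Set Implicit Arguments.
Unset Strict Implicit.
Unset Printing Implicit Defensive.
Import Order.TTheory GRing.Theory Num.Theory.
Local Open Scope ring_scope.
Local Open Scope classical_set_scope.

Definition hom (G H : sgraph) (h : G -> H) : Prop :=
  forall u v, edge u v -> edge (h u) (h v).

Lemma edge_neq (G : sgraph) (u v : G) : edge u v -> u != v.
Proof. by apply: contraTneq => ->; rewrite edge_irr. Qed.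

(** A proper colouring with n colours is the same thing as a homomorphism to the complete graph on n
    vertices, and the minimum defining [chromatic_number] is attained. *)
Lemma ex_coloring_hom (G : sgraph) :
  exists h : G -> complete_graph (chromatic_number G), hom h.
Proof.
rewrite /chromatic_number; case: ex_minnP => n /existsP[c cP] _.
by exists c => u v; move/forallP/(_ u)/forallP/(_ v)/implyP: cP; apply.
Qed.

(** The invariant carried through the induction on the number of factors. A map [p] replaces the
    identity because the vertex types of the two iterated products are not convertible for a
    variable number of factors. [splits_inj] and [splits_neq] supply the distinctness without which
    a representation of [S] or [C] says nothing about a pair of vertices. *)
Record splits (D S C : sgraph) (p : D -> S) (c : D -> C) : Prop := Splits {
  splits_inj : injective p;
  splits_homl : hom p;
  splits_homr : hom c;
  splits_neq : forall u v, edge (p u) (p v) -> c u != c v;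
  splits_edge : forall u v,
    edge (p u) (p v) -> edge (c u) (c v) -> edge u v }.

Lemma splits_id (G H : sgraph) (h : G -> H) : hom h -> splits id h.
Proof. by move=> hh; split=> // u v /hh /edge_neq. Qed.

Lemma splits_prod (D S C G H : sgraph) (p : D -> S) (c : D -> C) (h : G -> H) :
  splits p c -> hom h ->
  splits (fun u : direct_prod D G => (p u.1, u.2) : strong_prod S G)
         (fun u : direct_prod D G => (c u.1, h u.2) : direct_prod C H).
Proof.
move=> [pI pH cH cN pcE] hh; split.
- by move=> [u1 u2] [v1 v2] /= [/pI -> ->].
- move=> [u1 u2] [v1 v2] /= /andP[/= /pH e1 e2].
  rewrite /strong_edge /= e1 e2 !orbT !andbT.
  by apply: contraTneq e1 => -[-> _]; rewrite edge_irr.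
- by move=> u v /= /andP[/cH e1 /hh e2]; rewrite /direct_edge /= e1 e2.
(* Neighbours in a strong product are adjacent in at least one coordinate, and there their colours
   differ. *)
- move=> [u1 u2] [v1 v2] /= /and3P[/= uv e1 e2]; rewrite xpair_eqE negb_and.
  case/orP: e1 => [/eqP e1|/cN -> //].
  case/orP: e2 => [/eqP e2|/hh/edge_neq ->]; last by rewrite orbT.
  by rewrite e1 e2 eqxx in uv.
(* A coordinate in which the two vertices agree would give equal colours there, against adjacency in
   [C] or [H]; so both coordinates are adjacent. *)
- move=> [u1 u2] [v1 v2] /= /and3P[/= _ e1 e2] /andP[/= ec eh].
  rewrite /direct_edge /=; apply/andP; split.
    case/orP: e1 => [/eqP/pI e1|/pcE]; last exact.
    by rewrite e1 edge_irr in ec.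
  case/orP: e2 => // /eqP e2.
  by rewrite e2 edge_irr in eh.
Qed.

Lemma splits_iter_prod (d : nat) (G H : 'I_d.+1 -> sgraph) :
  (forall i, exists h : G i -> H i, hom h) ->
  exists (p : iter_prod direct_prod G -> iter_prod strong_prod G)
         (c : iter_prod direct_prod G -> iter_prod direct_prod H), splits p c.
Proof.
elim: d G H => [|d IH] G H GH /=.
  by have [h hh] := GH ord0; exists id, h; apply: splits_id.
have [h hh] := GH ord_max.
have [i|p [c pc]] := IH (fun i => G (widen_ord (leqnSn _) i))
                        (fun i => H (widen_ord (leqnSn _) i)); first exact: GH.
by eexists; eexists; apply: splits_prod pc hh.
Qed.

Section Representations.
Variable R : realType.

Definition prod_set k l (A : set 'rV[R]_k) (B : set 'rV[R]_l) :
    set 'rV[R]_(k + l) := [set x | A (lsubmx x) /\ B (rsubmx x)].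

(** The two blocks of coordinates are independent, so common points of each block can be glued by
    [row_mx]. *)
Lemma prod_setI_nonempty k l (A A' : set 'rV[R]_k) (B B' : set 'rV[R]_l) :
  prod_set A B `&` prod_set A' B' !=set0 <->
  A `&` A' !=set0 /\ B `&` B' !=set0.
Proof.
split=> [[x [[Ax Bx] [A'x B'x]]]|[[x [Ax A'x]] [y [By B'y]]]].
  by split; [exists (lsubmx x)|exists (rsubmx x)].
by exists (row_mx x y); split; split; rewrite ?row_mxKl ?row_mxKr.
Qed.

Definition cat_fun k l (a : 'I_k -> R) (b : 'I_l -> R) (i : 'I_(k + l)) : R :=
  match split i with inl j => a j | inr j => b j end.

Lemma cat_fun_lshift k l (a : 'I_k -> R) (b : 'I_l -> R) j :
  cat_fun a b (lshift l j) = a j.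
Proof. by rewrite /cat_fun -[lshift l j]/(unsplit (inl j)) unsplitK. Qed.

Lemma cat_fun_rshift k l (a : 'I_k -> R) (b : 'I_l -> R) j :
  cat_fun a b (rshift k j) = b j.
Proof. by rewrite /cat_fun -[rshift k j]/(unsplit (inr j)) unsplitK. Qed.

Definition cat_funE := (cat_fun_lshift, cat_fun_rshift).

Lemma forall_split k l (P : 'I_(k + l) -> Prop) :
  (forall i, P i) <->
  (forall i, P (lshift l i)) /\ (forall i, P (rshift k i)).
Proof.
split=> [HP|[Pl Pr] i]; first by split.
by rewrite -[i]splitK; case: (split i) => j; [exact: Pl|exact: Pr].
Qed.

Lemma is_box_prod k l (A : set 'rV[R]_k) (B : set 'rV[R]_l) :
  is_box A -> is_box B -> is_box (prod_set A B).
Proof.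
move=> [a [a' [aa' ->]]] [b [b' [bb' ->]]].
exists (cat_fun a b), (cat_fun a' b'); split.
  by apply/forall_split; split=> i; rewrite !cat_funE.
apply/seteqP; split=> x /=; rewrite forall_split.
  by move=> [xl xr]; split=> i; rewrite !cat_funE;
    [move: (xl i)|move: (xr i)]; rewrite mxE.
by move=> [xl xr]; split=> i; rewrite mxE;
  [move: (xl i)|move: (xr i)]; rewrite !cat_funE.
Qed.

Lemma is_cube_prod k l (A : set 'rV[R]_k) (B : set 'rV[R]_l) :
  is_cube A -> is_cube B -> is_cube (prod_set A B).
Proof.
move=> [a ->] [b ->]; exists (cat_fun a b).
apply/seteqP; split=> x /=; rewrite forall_split.
  by move=> [xl xr]; split=> i; rewrite !cat_funE;
    [move: (xl i)|move: (xr i)]; rewrite mxE.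
by move=> [xl xr]; split=> i; rewrite mxE;
  [move: (xl i)|move: (xr i)]; rewrite !cat_funE.
Qed.

Lemma splits_intersection_rep (D S C : sgraph) (p : D -> S) (c : D -> C) k l
    (f : S -> set 'rV[R]_k) (g : C -> set 'rV[R]_l) :
  splits p c -> is_intersection_rep f -> is_intersection_rep g ->
  is_intersection_rep (fun u => prod_set (f (p u)) (g (c u))).
Proof.
move=> [pI pH cH cN pcE] fr gr u v uv; rewrite prod_setI_nonempty; split.
  move=> e; have ep := pH _ _ e; have ec := cH _ _ e.
  by split; [apply/(fr _ _ (edge_neq ep))|apply/(gr _ _ (edge_neq ec))].
have puv : p u != p v by apply: contra_neq uv => /pI.
move=> [/(fr _ _ puv) ep fc].
(* Adjacency in [S] has to come first: it makes the colours distinct, and only then does the meeting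
   of the sets from [g] yield an edge of [C]. *)
by apply: (pcE _ _ ep); apply/(gr _ _ (cN _ _ ep)).
Qed.

Lemma splits_has_box_rep (D S C : sgraph) (p : D -> S) (c : D -> C) k l :
  splits p c -> has_box_rep R S k -> has_box_rep R C l ->
  has_box_rep R D (k + l).
Proof.
move=> pc [f [fb fr]] [g [gb gr]].
exists (fun u => prod_set (f (p u)) (g (c u))).
by split; [move=> u; apply: is_box_prod|apply: splits_intersection_rep].
Qed.

Lemma splits_has_cube_rep (D S C : sgraph) (p : D -> S) (c : D -> C) k l :
  splits p c -> has_cube_rep R S k -> has_cube_rep R C l ->
  has_cube_rep R D (k + l).
Proof.
move=> pc [f [fb fr]] [g [gb gr]].
exists (fun u => prod_set (f (p u)) (g (c u))).
by split; [move=> u; apply: is_cube_prod|apply: splits_intersection_rep].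
Qed.

Lemma boxicityP (G : sgraph) : has_box_rep R G (boxicity R G).
Proof. by rewrite /boxicity; case: ex_minnP => k /asboolP. Qed.

Lemma boxicity_le (G : sgraph) k : has_box_rep R G k -> (boxicity R G <= k)%N.
Proof.
by move=> Gk; rewrite /boxicity; case: ex_minnP => m _; apply; apply/asboolP.
Qed.

Lemma cubicityP (G : sgraph) : has_cube_rep R G (cubicity R G).
Proof. by rewrite /cubicity; case: ex_minnP => k /asboolP. Qed.

Lemma cubicity_le (G : sgraph) k : has_cube_rep R G k -> (cubicity R G <= k)%N.
Proof.
by move=> Gk; rewrite /cubicity; case: ex_minnP => m _; apply; apply/asboolP.
Qed.

End Representations.

Theorem theorem8 (R : realType) (d : nat) (G : 'I_d.+1 -> sgraph) :
  (boxicity R (iter_prod direct_prod G) <=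
     boxicity R (iter_prod strong_prod G) +
     boxicity R (iter_prod direct_prod
                   (fun i => complete_graph (chromatic_number (G i)))))%N /\
  (cubicity R (iter_prod direct_prod G) <=
     cubicity R (iter_prod strong_prod G) +
     cubicity R (iter_prod direct_prod
                   (fun i => complete_graph (chromatic_number (G i)))))%N.
Proof.
(* One pair of maps, built from optimal colourings of the factors, serves both inequalities. *)
have [p [c pc]] := splits_iter_prod (fun i => ex_coloring_hom (G i)).
split.
  by apply/boxicity_le/(splits_has_box_rep pc); apply: boxicityP.
by apply/cubicity_le/(splits_has_cube_rep pc); apply: cubicityP.
Qed.
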